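(* (a) If $n$ is an odd positive integer, then $$2S_n(n)\equiv n^2S_{n-1}(n)\pmod{n^3}.$$ (b) If $n$ is an even positive integer, then $$2S_{n+1}(n)-n(n+1)S_n(n)\equiv \begin{cases}0\pmod{n^3} & \text{if } n\equiv 0\pmod 4,\\ \frac{n^3}{2}\pmod{n^3} & \text{if } n\equiv 2\pmod 4.\end{cases}$$ (c) If $n$ is an even positive integer, then also $$2S_{n-1}(n)\equiv n(n-1)S_{n-2}(n)\pmod{n^3}.$$ (d) In particular, for each even positive integer $n$, $$S_{n-1}(n)\equiv \begin{cases}0\pmod{n} & \text{if } n\equiv 0\pmod 4,\\ \frac{n}{2}\pmod{n} & \text{if } n\equiv 2\pmod 4.\end{cases}$$
   Context: For integers $k\ge 0$ and $n\ge 1$, $S_k(n):=\sum_{i=1}^{n-1} i^k$ (empty sum $=0$ for $n=1$; $S_0(n)=n-1$).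
   Formalization: Part (c) is proved for every even positive n except n = 4, where it is false: 2S_3(4) = 72 ≡ 8 but 4·3·S_2(4) = 168 ≡ 40 (mod 64). *)

(* Defs.v *)
From mathcomp Require Import all_boot all_order all_algebra.

Set Implicit Arguments.
Unset Strict Implicit.
Unset Printing Implicit Defensive.

Definition power_sum (k n : nat) : nat := \sum_(1 <= i < n) i ^ k.

(* For even n, the congruence
     2 S_{n-1}(n) = n (n-1) S_{n-2}(n)  (mod n^3)
   fails at n = 4: there 2 * 36 = 72 is 8 and 12 * 14 = 168 is 40 modulo 64.
   The pairing i <-> n - i leaves the extra term
   n^2 * binom(n-1, 2) * S_{n-3}(n), which is divisible by n^3 for every
   other even n (it is 0 for n = 2), but not for n = 4, where the inner sum
   is S_1(4) = 6. *)
Fact congruence_fails_at_4 :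
  2 * power_sum 3 4 <> 4 * 3 * power_sum 2 4 %[mod 4 ^ 3].
Proof. by rewrite /power_sum unlock. Qed.

(* Main.v *)
Require Import Defs.
From mathcomp Require Import all_boot all_order all_algebra.
From mathcomp Require Import zify ring.
Import GRing.Theory.

(** Write S_k for the sum of i^k over 0 < i < n. Reversing the sum replaces i
by n - i, so 2 S_k is the sum of i^k + (n - i)^k. For odd k >= 3 the binomial
expansion of (n - i)^k modulo n^3 has leading term - i^k, which cancels, and
leaves [power_sum_reflection]:
<<
  2 S_k = k n S_(k-1) - binom(k, 2) n^2 S_(k-2)   modulo n^3.
>>
Claims (a), (b) and (c) are the cases k = n, n + 1 and n - 1, once the last
term is known modulo n^3. For k = n odd, n divides binom(n, 2) and the term
vanishes. For even n = 2h it is controlled by S_(k-2) modulo n, an odd power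
sum: the pairs {i, 2h - i} contribute multiples of 2h and only the middle term
h^(k-2) survives ([power_sum_odd_double]). That term is 0 modulo 2h when h is
even and the exponent exceeds 1, and h when h is odd. This dichotomy with
exponent n - 1 is claim (d). In (b) it gives the parity of S_(n-1), hence the
value of binom(n + 1, 2) n^2 S_(n-1) = (n + 1) S_(n-1) n^3 / 2. In (c) it shows
that n divides binom(n - 1, 2) S_(n-3) = (n - 1) (h - 1) S_(n-3), except for
n = 4, where the exponent n - 3 is 1. *)

(** The binomial theorem truncated at x^3, to be used with x = n, y = - i. *)
Lemma exprD_mod_cube (R : comPzRingType) (x y : R) (m : nat) :
  exists q : R, ((x + y) ^+ m.+2 =
    y ^+ m.+2 + x * y ^+ m.+1 *+ m.+2 + x ^+ 2 * y ^+ m *+ 'C(m.+2, 2)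
    + x ^+ 3 * q)%R.
Proof.
elim: m => [|m [q IH]].
  by exists 0%R; rewrite (_ : 'C(2, 2) = 1) //; ring.
exists (y ^+ m *+ 'C(m.+2, 2) + (x + y) * q)%R.
rewrite exprS IH [in RHS]binS bin1 !exprS; ring.
Qed.

Lemma power_sum_rev (k n : nat) :
  power_sum k n = \sum_(1 <= i < n) (n - i) ^ k.
Proof. by rewrite /power_sum big_nat_rev; apply: eq_bigr. Qed.

(** Apply [exprD_mod_cube] to (n - i)^(m+2): since m is odd, the signs of the
terms in i^(m+2), i^(m+1), i^m are -, +, -. Writing the exponent as m+2 keeps
all three exponents free of truncated subtraction. *)
Lemma power_sum_reflection (n m : nat) : odd m ->
  exists q : int, ((power_sum m.+2 n)%:Z *+ 2 =
    n%:Z * (power_sum m.+1 n)%:Z *+ m.+2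
    - n%:Z ^+ 2 * (power_sum m n)%:Z *+ 'C(m.+2, 2) + n%:Z ^+ 3 * q)%R.
Proof.
move=> om.
suff /dvdzP[q Eq]: ((n%:Z ^+ 3)%R %|
    (\sum_(1 <= i < n) ((i ^ m.+2)%N%:Z + ((n - i) ^ m.+2)%N%:Z
       - n%:Z * (i ^ m.+1)%N%:Z *+ m.+2
       + n%:Z ^+ 2 * (i ^ m)%N%:Z *+ 'C(m.+2, 2)))%R)%Z.
  exists q; move: Eq; rewrite big_split /= sumrB big_split /=.
  rewrite !sumrMnl -!mulr_sumr -!(big_morph _ PoszD (erefl (Posz 0))).
  rewrite -power_sum_rev -!/(power_sum _ _) => Eq.
  by rewrite [(_ ^+ 3 * q)%R]mulrC -Eq; ring.
rewrite big_nat; apply: rpred_sum => i /andP[_ ltin].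
have [q Eq] := @exprD_mod_cube int n%:Z (- i%:Z)%R m.
apply/dvdzP; exists q.
rewrite -!natz !natrX natrB ?(ltnW ltin) // !natz Eq !(exprNn i%:Z).
rewrite !exprS -(signr_odd _ m) om; ring.
Qed.

(** Two steps at a time, by a^(k+2) + b^(k+2) + ab (a^k + b^k)
= (a + b) (a^(k+1) + b^(k+1)), which avoids an alternating cofactor in nat. *)
Lemma dvdn_odd_expD (a b k : nat) : odd k -> a + b %| a ^ k + b ^ k.
Proof.
move=> ok; rewrite -(odd_double_half k) ok add1n.
elim: k./2 => [|j IH]; first by [].
rewrite -(dvdn_addl _ (dvdn_mull (a * b) IH)) doubleS.
apply/dvdnP; exists (a ^ j.*2.+2 + b ^ j.*2.+2); rewrite !expnS; ring.
Qed.

(** For 0 < i < h the terms of index i and 2h - i add up to a multiple of 2h,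
which leaves the unpaired index h. *)
Lemma power_sum_odd_double (k h : nat) : odd k -> 0 < h ->
  power_sum k h.*2 = h ^ k %[mod h.*2].
Proof.
move=> ok h0; rewrite /power_sum (@big_cat_nat _ _ _ h) /=; try lia.
rewrite [X in _ + X]big_ltn; last by lia.
have -> : \sum_(h.+1 <= i < h.*2) i ^ k = \sum_(1 <= i < h) (h.*2 - i) ^ k.
  rewrite big_nat_rev /= -{1}add1n big_addn.
  rewrite (_ : h.*2 - h = h); last by lia.
  by rewrite !big_nat; apply: eq_bigr => i Hi; congr (_ ^ _); lia.
rewrite addnCA -big_split /= -modnDmr.
suff /eqP -> : (\sum_(1 <= i < h) (i ^ k + (h.*2 - i) ^ k)) %% h.*2 == 0.
  by rewrite addn0.
rewrite -/(h.*2 %| _) big_nat; apply: dvdn_sum => i /andP[_ ltih].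
by rewrite -{1}(subnKC (_ : i <= h.*2)) ?dvdn_odd_expD //; lia.
Qed.

(** With h even, h^2 = 2h (h/2) already vanishes modulo 2h. The exponent 1 is
a true exception: there the sum is h modulo 2h. *)
Lemma power_sum_odd_double_even (k h : nat) : odd k -> 1 < k -> 0 < h ->
  ~~ odd h -> h.*2 %| power_sum k h.*2.
Proof.
move=> ok k1 h0 eh; rewrite /dvdn power_sum_odd_double //.
case: k k1 {ok} => [//|[//|k]] _; rewrite -/(_ %| _) -(addn2 k) expnD.
by rewrite dvdn_mull // -muln2 expnS expn1 dvdn_mul ?dvdn2.
Qed.

(** An odd multiple of h is h modulo 2h, and h^(k-1) is odd. *)
Lemma power_sum_odd_double_odd (k h : nat) : odd k -> odd h ->
  power_sum k h.*2 = h %[mod h.*2].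
Proof.
move=> ok oh; rewrite power_sum_odd_double ?odd_gt0 //.
case: k ok => [//|k] _.
have ohk : odd (h ^ k) by rewrite oddX oh orbT.
rewrite expnS -[h ^ k]odd_double_half ohk.
have -> : h * (true + (h ^ k)./2.*2) = (h ^ k)./2 * h.*2 + h by lia.
by rewrite modnMDl.
Qed.

Lemma eqn_mod_int (a b d : nat) (q : int) :
  (a%:Z = b%:Z + d%:Z * q)%R -> a = b %[mod d].
Proof.
move=> E; apply/eqP; rewrite -eqz_nat -!modz_nat eqz_mod_dvd.
by apply/dvdzP; exists q; rewrite E; ring.
Qed.

Theorem corollary2p1 :
  [/\ (forall n : nat, odd n ->
         2 * power_sum n n = n ^ 2 * power_sum n.-1 n %[mod n ^ 3]),
      (forall n : nat, 0 < n -> ~~ odd n ->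
         (n = 0 %[mod 4] ->
            ((2 * power_sum n.+1 n)%N%:Z - (n * n.+1 * power_sum n n)%N%:Z
               = 0 %[mod (n ^ 3)%N%:Z])%Z) /\
         (n = 2 %[mod 4] ->
            ((2 * power_sum n.+1 n)%N%:Z - (n * n.+1 * power_sum n n)%N%:Z
               = (n ^ 3 %/ 2)%N%:Z %[mod (n ^ 3)%N%:Z])%Z)),
      (forall n : nat, 0 < n -> ~~ odd n -> n <> 4 ->
         2 * power_sum n.-1 n = n * n.-1 * power_sum n.-2 n %[mod n ^ 3])
    & (forall n : nat, 0 < n -> ~~ odd n ->
         (n = 0 %[mod 4] -> power_sum n.-1 n = 0 %[mod n]) /\
         (n = 2 %[mod 4] -> power_sum n.-1 n = n %/ 2 %[mod n]))].
Proof.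
split.
- move=> n; case: n => [//|[_|[//|m]]].
    (* n = 1: the reflection needs an exponent of at least 3. *)
    by rewrite !modn1.
  rewrite /= negbK => om; have [q Eq] := power_sum_reflection m.+3 m.+1 om.
  have [c Ec] : exists c, 'C(m.+3, 2) = m.+3 * c.
    by exists m.+2./2; rewrite bin2 /=; lia.
  apply: (@eqn_mod_int _ _ _ (q - (c * power_sum m.+1 m.+3)%N%:Z)%R).
  move: Eq; rewrite Ec; set n := m.+3; set S := power_sum; lia.
- move=> n n0 en; have [h En] : exists h, n = h.*2 by exists n./2; lia.
  case: n n0 en En => [//|m] _ en En; have om : odd m by lia.
  have [q Eq] := power_sum_reflection m.+1 m om.
  have Ec : 'C(m.+2, 2) = h * m.+2 by rewrite bin2 /= En; lia.
  rewrite Ec in Eq; split=> n4; apply/eqP; rewrite eqz_mod_dvd; apply/dvdzP.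
    (* n divides S_(n-1), so the error h n^2 (n+1) S_(n-1) is a multiple of n^3. *)
    have /dvdnP[s Es] : m.+1 %| power_sum m m.+1.
      by rewrite En; apply: power_sum_odd_double_even; lia.
    exists (q - (h * m.+2 * s)%N%:Z)%R; move: Eq; rewrite Es; lia.
  (* (n+1) S_(n-1) is odd, so the error is h n^2 = n^3 / 2 up to multiples of
     n^3 = 2 h n^2; the extra - 1 in the quotient turns - h n^2 into h n^2. *)
  have Es : power_sum m m.+1 = h %[mod m.+1].
    by rewrite En; apply: power_sum_odd_double_odd; lia.
  have [u Eu] : exists u, m.+2 * power_sum m m.+1 = u.*2.+1.
    exists (m.+2 * power_sum m m.+1)./2.
    have : odd (power_sum m m.+1).
      rewrite (divn_eq (power_sum m m.+1) m.+1) Es modn_small; last by lia.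
      by rewrite oddD oddM; lia.
    by move=> oS; rewrite -[LHS]odd_double_half oddM oS andbT; lia.
  have -> : m.+1 ^ 3 %/ 2 = h * m.+1 ^ 2.
    by rewrite expnS {1}En -muln2 mulnAC mulnK.
  exists (q - u%:Z - 1)%R.
  have E2 : (m.+1 ^ 3)%N = 2 * (h * m.+1 ^ 2) by rewrite expnS {1}En -mul2n mulnA.
  move: Eq; set X := power_sum m.+2 _; set Y := power_sum m.+1 _.
  have -> : ((m.+1)%:Z ^+ 2 * (power_sum m m.+1)%:Z *+ (h * m.+2)
      = (h * m.+1 ^ 2 * u.*2.+1)%N%:Z)%R.
    by rewrite -Eu -mulr_natr natz -!PoszM expnS expn1; congr Posz; ring.
  have -> : ((m.+1)%:Z ^+ 3 = (m.+1 ^ 3)%N%:Z)%R by lia.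
  rewrite E2; lia.
- move=> n n0 en n4; have [h En] : exists h, n = h.*2 by exists n./2; lia.
  case: n n0 en n4 En => [//|[//|[_ _ _ _|m]]].
    by rewrite /power_sum /= !big_nat1.
  move=> _ en n4 En; have om : odd m by lia.
  have [q Eq] := power_sum_reflection m.+3 m om.
  have Ec : 'C(m.+2, 2) = m.+2 * h.-1 by rewrite bin2 /=; lia.
  have [c Ecs] : exists c, h.-1 * power_sum m m.+3 = m.+3 * c.
    suff /dvdnP[c Edv] : m.+3 %| h.-1 * power_sum m m.+3.
      by exists c; rewrite Edv mulnC.
    (* For odd h, S_(n-3) supplies the factor h and h - 1 the factor 2; for even
       h, S_(n-3) is a multiple of 2h, as n <> 4 makes n - 3 larger than 1. *)
    case oh: (odd h).
      have Es : power_sum m m.+3 = h %[mod m.+3].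
        by rewrite En; apply: power_sum_odd_double_odd.
      rewrite /dvdn -modnMmr Es modnMmr -/(dvdn _ _).
      have Eh : h.-1 = h.-1./2 * 2 by lia.
      by apply/dvdnP; exists h.-1./2; rewrite {1}Eh En -mul2n mulnA.
    by apply: dvdn_mull; rewrite En; apply: power_sum_odd_double_even; lia.
  apply: (@eqn_mod_int _ _ _ (q - (m.+2 * c)%N%:Z)%R).
  move: Eq; rewrite Ec.
  have -> : ((m.+3)%:Z ^+ 2 * (power_sum m m.+3)%:Z *+ (m.+2 * h.-1)
      = (m.+3 ^ 3 * (m.+2 * c))%N%:Z)%R.
    rewrite -mulr_natr natz -!PoszM; congr Posz.
    by rewrite -mulnA [X in _ * X]mulnCA [_ * h.-1]mulnC Ecs; ring.
  have -> : ((m.+3)%:Z ^+ 3 = (m.+3 ^ 3)%N%:Z)%R by lia.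
  rewrite /=; lia.
move=> n n0 en; have [h En] : exists h, n = h.*2 by exists n./2; lia.
split=> n4.
  apply/eqP; rewrite mod0n -/(dvdn _ _) {2}En En.
  by apply: power_sum_odd_double_even; lia.
have -> : n %/ 2 = h by lia.
by rewrite En; apply: power_sum_odd_double_odd; lia.
Qed.
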